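(* Let $\alpha,\beta>0$ be fixed constants, let $n$ be sufficiently large, and let $f(n)$ be any function satisfying $f(n)\to\infty$ as $n\to\infty$. Let $a,b$ (integers) and $p\in(0,1]$ be functions of $n$ which satisfy $\ln^2 n\le a\le b\le n$, $ap\le\alpha\cdot\ln n$ and $bp>n^{\beta}$. Then, for $G\sim G(A,B,p)$, where $|A|=a$ and $|B|=b$, $$\mathbb{P}\left(\exists\text{ a dominating set } D\subset B \text{ of } A \text{ with } |D|\le\frac{f(n)}{p}\ \Big|\ \forall v\in A,\ N(v)\ne\emptyset\right)\ \ge\ 1-\exp\left[-b^{1-o(1)}\right],$$ where $o(1)$ denotes a quantity tending to $0$ as $n\to\infty$.
   Context: For disjoint sets $A,B$ and $p\in[0,1]$, $G(A,B,p)$ is the random bipartite graph with parts $A$ and $B$ in which each edge with one endpoint in $A$ and the other in $B$ is included independently with probability $p$. $N(v)$ denotes the neighbourhood of the vertex $v$. A set $D\subseteq B$ is a dominating set of $A$ if every vertex of $A$ has at least one neighbour in $D$. *)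

(* Defs.v *)
From HB Require Import structures.
From mathcomp Require Import all_boot all_order all_algebra.
From mathcomp Require Import all_classical all_reals all_analysis.

Set Implicit Arguments.
Unset Strict Implicit.
Unset Printing Implicit Defensive.

Import Order.TTheory GRing.Theory Num.Theory.
Import numFieldNormedType.Exports.

Local Open Scope ring_scope.

(* A bipartite graph with parts A and B is encoded by its set of edges, the
   edge between v : A and w : B being the pair (v, w); the parts are distinct
   types, hence disjoint. *)
Definition bigraph (A B : finType) : finType := {set A * B}.

Definition nbhd (A B : finType) (G : bigraph A B) (v : A) : {set B} :=
  [set w | (v, w) \in (G : {set A * B})].

Definition dominating (A B : finType) (G : bigraph A B) (D : {set B}) : bool :=
  [forall v : A, [exists w in D, w \in nbhd G v]].

Definition no_isolated (A B : finType) (G : bigraph A B) : bool :=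
  [forall v : A, nbhd G v != finset.set0].

(* Law of G(A, B, p): independence of the edges makes the mass of a graph the
   product over all pairs e of p (e is present) or 1 - p (e is absent). *)
Definition gnp_mass (R : realType) (A B : finType) (p : R) (G : bigraph A B)
    : R :=
  \prod_(e : A * B) (if e \in (G : {set A * B}) then p else 1 - p).

Definition gnp_prob (R : realType) (A B : finType) (p : R)
    (E : pred (bigraph A B)) : R :=
  \sum_(G : bigraph A B | E G) gnp_mass p G.

(* P(E | F), meaningful when P(F) != 0. *)
Definition gnp_cond (R : realType) (A B : finType) (p : R)
    (E F : pred (bigraph A B)) : R :=
  gnp_prob p (predI E F) / gnp_prob p F.

(* Main.v *)
(* Write L = ln n and let c tend to 0 slowly. For every U in A with |U| > 1/p
   a fixed vertex of B has at least g = c L sqrt (|U| p / (alpha L)) neighbours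
   in U with probability at least q = n^(-O(c)): restricting to a part S of U of
   size s ~ c |U|, this is at least C(s, g) p^g (1 - p)^s >= (s p / g)^g (1 - p)^s,
   where g^2 / (s p) and s p are both O(c L). Since the b vertices of B are
   independent, and a is much smaller than b q, a union bound over the 2^a sets U
   shows that outside an event of probability exp (a - b q), every such U has a
   vertex of B with g neighbours in it. Then a greedy choice needs O(1/(c p))
   vertices to leave at most 1/p vertices uncovered: it is essential that
   int_0^1 dx / sqrt x is finite. The last ones are covered one by one, using that
   there are no isolated vertices, a condition which has probability >= 1/2. *)
Require Import Defs.
From HB Require Import structures.
From mathcomp Require Import all_boot all_order all_algebra.
From mathcomp Require Import all_classical all_reals all_analysis.
From mathcomp Require Import ring lra.

Import Order.TTheory GRing.Theory Num.Theory.
Import numFieldNormedType.Exports.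

Local Open Scope ring_scope.

(** * Random subsets *)

(** [gnp_mass] is convertible to this weight at [T := A * B], so facts about random subsets apply to
    random graphs directly. *)
Definition bern {R : realType} {T : finType} (p : R) (X : {set T}) : R :=
  \prod_(t : T) (if t \in X then p else 1 - p).

Lemma bern_ge0 {R : realType} {T : finType} (p : R) (X : {set T}) :
  0 <= p <= 1 -> 0 <= bern p X.
Proof.
by move=> /andP[p0 p1]; apply: prodr_ge0 => t _; case: ifP; rewrite ?subr_ge0.
Qed.

Lemma sum_bern {R : realType} {T : finType} (p : R) :
  \sum_(X : {set T}) bern p X = 1.
Proof.
transitivity (\prod_(t : T) (p + (1 - p))).
  by rewrite bigA_distr; apply: eq_big.
by rewrite big1 // => t _; rewrite addrC subrK.
Qed.

(** Independence of the rows of a random 0-1 matrix. The map [phi] lays [T] out as a matrix, so that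
    one statement serves both for neighbourhoods of vertices of [A] and, with coordinates swapped,
    of [B]. A set is the same as its family of rows, and distributing the product over the sums
    enumerates these families. *)
Lemma prob_rows {R : realType} {I J T : finType} (p : R) (phi : I -> J -> T)
    (Q : I -> pred {set J}) :
  bijective (fun ij : I * J => phi ij.1 ij.2) ->
  \sum_(G : {set T} | [forall i, Q i [set j | phi i j \in G]]) bern p G =
  \prod_i \sum_(X | Q i X) bern p X.
Proof.
case=> psi phiK psiK.
have phiE i j : psi (phi i j) = (i, j) by rewrite (phiK (i, j)).
under [RHS]eq_bigr => i _ do rewrite big_mkcond.
rewrite bigA_distr_bigA big_mkcond.
rewrite (reindex (fun f : {ffun I -> {set J}} =>
                    [set t | (psi t).2 \in f (psi t).1])) /=; last first.
  exists (fun G : {set T} => [ffun i => [set j | phi i j \in G]]) => [f _|G _].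
    by apply/ffunP => i; apply/setP => j; rewrite ffunE !inE phiE.
  by apply/setP => t; rewrite inE ffunE inE; rewrite psiK.
apply: eq_bigr => f _.
have rowE i : [set j | phi i j \in [set t | (psi t).2 \in f (psi t).1]] = f i.
  by apply/setP => j; rewrite !inE phiE.
case: ifPn => [/forallP allQ|].
  rewrite {1}/bern (reindex (fun ij : I * J => phi ij.1 ij.2)); last first.
    by exists psi => x _; rewrite ?phiK ?psiK.
  rewrite -(pair_bigA _ (fun i j => if phi i j \in [set t | (psi t).2 \in f (psi t).1]
    then p else 1 - p)) /=; apply: eq_bigr => i _.
  have := allQ i; rewrite rowE => ->.
  by apply: eq_bigr => j _; rewrite inE phiE.
rewrite negb_forall => /existsP[i]; rewrite rowE => NQ.
by rewrite (bigD1 i) //= (negbTE NQ) mul0r.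
Qed.

Lemma prob_capE {R : realType} {T : finType} (p : R) (S Y : {set T}) :
  Y \subset S ->
  \sum_(X : {set T} | X :&: S == Y) bern p X =
  p ^+ #|Y| * (1 - p) ^+ (#|S| - #|Y|).
Proof.
move=> YS.
(* [F t] and [G t] are the weights of having [t] inside or outside [X], replaced by 0 where that
   choice contradicts [X :&: S = Y]. Expanding the product of the sums [F t + G t] therefore keeps
   exactly the admissible [X]. *)
pose F t := if t \in S then (if t \in Y then p else 0) else p.
pose G t := if t \in S then (if t \in Y then 0 else 1 - p) else 1 - p.
transitivity (\prod_t (F t + G t)).
  rewrite bigA_distr big_mkcond; apply: eq_big => // X _.
  case: eqP => [XSY|/eqP XS].
    apply: eq_bigr => t _; rewrite /F /G -XSY !inE.
    by case: (t \in X); case: (t \in S).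
  have [t tP] : exists t, (t \in X :&: S) != (t \in Y).
    apply/existsP; move: XS; apply: contraR => /existsPn XS.
    by apply/eqP/setP => t; apply/eqP; have := XS t; rewrite negbK.
  rewrite (bigD1 t) //= /F /G; move: tP (fintype.subsetP YS t); rewrite inE.
  by case: (t \in X); case: (t \in S); case: (t \in Y) => //= _;
    rewrite ?mul0r // => /(_ isT).
rewrite -cardsDS // (bigID (mem Y)) /= (bigID (mem (S :\: Y)) (fun t => t \notin Y)) /=.
rewrite [X in _ * (_ * X)]big1 ?mulr1; last first.
  move=> t; rewrite inE => /andP[tY]; rewrite tY /= /F /G => /negbTE ->.
  by rewrite addrC subrK.
congr (_ * _).
  rewrite -[RHS]prodr_const; apply: eq_bigr => t tY.
  by rewrite /F /G (fintype.subsetP YS) // tY addr0.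
rewrite -[RHS]prodr_const; apply: eq_big => t; first by rewrite !inE; case: (t \in Y).
by rewrite inE /F /G => /andP[/negbTE -> /andP[_ ->]]; rewrite add0r.
Qed.

Lemma prob_nonempty {R : realType} {T : finType} (p : R) :
  \sum_(X : {set T} | X != finset.set0) bern p X = 1 - (1 - p) ^+ #|T|.
Proof.
have: \sum_(X : {set T} | X == finset.set0) bern p X = (1 - p) ^+ #|T|.
  rewrite (eq_bigl (fun X : {set T} => X :&: [set: T]%SET == finset.set0)).
    2: by move=> X; rewrite finset.setIT.
  by rewrite prob_capE ?finset.sub0set // cards0 cardsT subn0 expr0 mul1r.
have := @sum_bern R T p; rewrite (bigID (fun X => X == finset.set0)) /=.
by move=> <- <-; rewrite addrC addrK.
Qed.

Lemma expr_div_le_bin {R : realType} (s g : nat) : (g <= s)%N ->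
  (s%:R / g%:R) ^+ g <= ('C(s, g))%:R :> R.
Proof.
elim: g s => [|g IHg] [|s] //.
rewrite ltnS => gs; have g0 : (0 : R) < g.+1%:R by rewrite ltr0n.
have : g.+1%:R * ('C(s.+1, g.+1))%:R = s.+1%:R * ('C(s, g))%:R :> R.
  by rewrite -!natrM mul_bin_diag.
move/(canRL (mulKf (lt0r_neq0 g0))) => ->.
rewrite exprS mulrA [_^-1 * _]mulrC ler_pM2l ?divr_gt0 ?ltr0n //.
(* The base only grows: [s.+1 / g.+1 <= s / g] when [g <= s]. The case [g = 0] is apart because
   there [s / g] is 0 by convention, while both powers are 1. *)
apply: le_trans (IHg _ gs); case: (posnP g) => [->|gp]; first by rewrite !expr0.
apply: lerXn2r; rewrite ?nnegrE ?divr_ge0 //.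
rewrite ler_pdivrMr // mulrAC ler_pdivlMr ?ltr0n // -!natrM ler_nat.
by rewrite mulSn mulnS leq_add2r.
Qed.

(** Keep only the traces on [S] of size exactly [g]: there are ['C(#|S|, g)] of them, and the
    exponent [#|S| - g] may be raised to [#|S|]. *)
Lemma prob_cap_ge {R : realType} {T : finType} (p : R) (S : {set T}) (g : nat) :
  0 <= p <= 1 -> (g <= #|S|)%N ->
  (#|S|%:R * p / g%:R) ^+ g * (1 - p) ^+ #|S| <=
  \sum_(X : {set T} | (g <= #|X :&: S|)%N) bern p X.
Proof.
move=> p01 gS; have /andP[p0 p1] := p01.
apply: (@le_trans _ _ (\sum_(Y in [set Y : {set T} | Y \subset S & #|Y| == g])
    \sum_(X : {set T} | X :&: S == Y) bern p X)); last first.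
  rewrite [leRHS](partition_big (fun X => X :&: S) predT) //= big_mkcond.
  apply: ler_sum => Y _; case: ifPn => [|_]; last first.
    by apply: sumr_ge0 => *; exact: bern_ge0.
  rewrite inE => /andP[_ /eqP gY].
  rewrite le_eqVlt; apply/orP; left; apply/eqP; apply: eq_bigl => X.
  by case: eqP => [->|]; rewrite ?andbT ?andbF // gY leqnn.
rewrite (eq_bigr (fun=> p ^+ g * (1 - p) ^+ (#|S| - g))); last first.
  by move=> Y; rewrite inE => /andP[/prob_capE -> /eqP ->].
rewrite sumr_const cards_draws -[leRHS]mulr_natl mulrA [_ * p * _]mulrAC.
have p'0 : 0 <= 1 - p by rewrite subr_ge0.
apply: ler_pM; rewrite ?exprn_ge0 ?divr_ge0 ?mulr_ge0 //.
  rewrite exprMn.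
  by apply: ler_wpM2r; rewrite ?exprn_ge0 ?expr_div_le_bin.
by rewrite ler_wiXn2l ?lerBlDr ?lerDl // leq_subr.
Qed.

(** * Expansion and greedy domination *)

Definition conbhd {A B : finType} (G : bigraph A B) (w : B) : {set A} :=
  [set v | (v, w) \in (G : {set A * B})].

Definition expanding {R : realType} {A B : finType} (theta x : R)
    (G : bigraph A B) : bool :=
  [forall U : {set A}, (x < #|U|%:R) ==>
    [exists w, theta * Num.sqrt #|U|%:R <= #|conbhd G w :&: U|%:R]].

(** With [t = sqrt u] and [r = sqrt (u - k)], [k = (t - r) * (t + r) <= 2 * t * (t - r)], so
    [theta * t <= k] forces [t - r >= theta / 2]. *)
Lemma sqrt_potential {R : realType} (theta u k : R) :
  0 < theta -> 0 < u -> 0 <= k <= u -> theta * Num.sqrt u <= k ->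
  1 + 2 * Num.sqrt (u - k) / theta <= 2 * Num.sqrt u / theta.
Proof.
move=> theta0 u0 /andP[k0 ku] uk.
have t0 : 0 < Num.sqrt u by rewrite sqrtr_gt0.
have r0 := sqrtr_ge0 (u - k).
have tE : Num.sqrt u ^+ 2 = u by rewrite sqr_sqrtr // ltW.
have rE : Num.sqrt (u - k) ^+ 2 = u - k by rewrite sqr_sqrtr // subr_ge0.
rewrite ler_pdivlMr // mulrDl divfK ?gt_eqF // mul1r.
move: (Num.sqrt u) (Num.sqrt (u - k)) t0 r0 tE rE uk => t r t0 r0 tE rE uk.
have k2 : k <= 2 * t * (t - r) by nra.
by rewrite -(ler_pM2l t0); nra.
Qed.

(* Each new vertex of [D] covers at least [theta * sqrt u] of the [u] vertices
   still uncovered, so it costs at most the drop of the potential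
   [2 * sqrt u / theta]; the last [x] vertices are covered one by one. *)
Lemma expanding_dominating {R : realType} {A B : finType} (theta x : R)
    (G : bigraph A B) :
  0 < theta -> 0 <= x -> expanding theta x G -> no_isolated G ->
  exists D : {set B}, dominating G D /\
    #|D|%:R <= 2 * Num.sqrt #|A|%:R / theta + x.
Proof.
move=> theta0 x0 /forallP expG /forallP isoG.
(* Generalised from [A] to any set of still uncovered vertices, for strong induction on its size. *)
suff cover (U : {set A}) : exists D : {set B},
    (forall v, v \in U -> exists2 w, w \in D & (v, w) \in (G : {set A * B})) /\
    #|D|%:R <= 2 * Num.sqrt #|U|%:R / theta + x.
  have [D [DU Dle]] := cover [set: A]%SET; exists D; split; last by rewrite -cardsT.
  apply/forallP => v; apply/existsP; have [|w wD vw] := DU v; first by rewrite inE.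
  by exists w; rewrite wD inE.
have [k] := ubnP #|U|; elim: k U => // k IHk U; rewrite ltnS => Uk.
have [xU|Ux] := ltP x #|U|%:R; last first.
  have nb v : exists w, (v, w) \in (G : {set A * B}).
    by have /set0Pn[w] := isoG v; rewrite inE; exists w.
  pose h v := xchoose (nb v).
  exists (h @: U); split => [v vU|].
    by exists (h v); [exact: imset_f | exact: xchooseP (nb v)].
  apply: le_trans (_ : #|U|%:R <= _); first by rewrite ler_nat leq_imset_card.
  by rewrite (le_trans Ux) // lerDr divr_ge0 ?mulr_ge0 ?sqrtr_ge0 // ltW.
have U0 : (0 : R) < #|U|%:R by exact: le_lt_trans xU.
have /existsP[w wU] := implyP (expG U) xU.
have cardU : #|U :\: conbhd G w|%:R = #|U|%:R - #|conbhd G w :&: U|%:R :> R.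
  by rewrite [conbhd G w :&: U]finset.setIC cardsD natrB // subset_leq_card // subsetIl.
have [|D [DU Dle]] := IHk (U :\: conbhd G w).
  have : (0 : R) < #|conbhd G w :&: U|%:R.
    by apply: lt_le_trans wU; rewrite mulr_gt0 // sqrtr_gt0.
  rewrite -(ltr_nat R); move: Uk; rewrite -(ler_nat R) cardU; lra.
exists (w |: D)%SET; split => [v vU|].
  have [vw|vw] := boolP ((v, w) \in (G : {set A * B})).
    by exists w; rewrite // !inE eqxx.
  have [|w' w'D vw'] := DU v; first by rewrite !inE vw.
  by exists w'; rewrite // !inE w'D orbT.
have := @sqrt_potential R theta #|U|%:R #|conbhd G w :&: U|%:R theta0 U0 _ wU.
rewrite ler0n ler_nat subset_leq_card ?subsetIr // => /(_ isT) pot.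
apply: le_trans (_ : 1 + #|D|%:R <= _).
  by rewrite nat1r ler_nat cardsU1 -add1n leq_add2r leq_b1.
by rewrite (le_trans _ (lerD pot (lexx x))) // -addrA lerD2l -cardU.
Qed.

(** * The random bipartite graph *)

Lemma gnp_prob_neighbourhoods {R : realType} {A B : finType} (p : R)
    (Q : pred {set B}) :
  gnp_prob p (fun G : bigraph A B => [forall v, Q (nbhd G v)]) =
  (\sum_(X | Q X) bern p X) ^+ #|A|.
Proof.
rewrite -prodr_const; apply: (@prob_rows R A B _ p (fun v w => (v, w)) (fun=> Q)).
by exists id => -[].
Qed.

Lemma gnp_prob_conbhd {R : realType} {A B : finType} (p : R)
    (Q : pred {set A}) :
  gnp_prob p (fun G : bigraph A B => [forall w, Q (conbhd G w)]) =
  (\sum_(X | Q X) bern p X) ^+ #|B|.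
Proof.
rewrite -prodr_const; apply: (@prob_rows R B A _ p (fun w v => (v, w)) (fun=> Q)).
by exists (fun vw => (vw.2, vw.1)) => -[].
Qed.

Lemma gnp_prob_no_isolated {R : realType} {A B : finType} (p : R) :
  gnp_prob p (fun G : bigraph A B => no_isolated G) =
  (1 - (1 - p) ^+ #|B|) ^+ #|A|.
Proof. by rewrite -prob_nonempty -gnp_prob_neighbourhoods. Qed.

Lemma gnp_prob_sub {R : realType} {A B : finType} (p : R)
    (E F : pred (bigraph A B)) : 0 <= p <= 1 ->
  (forall G, E G -> F G) -> gnp_prob p E <= gnp_prob p F.
Proof.
move=> p01 EF; rewrite /gnp_prob big_mkcond [leRHS]big_mkcond.
apply: ler_sum => G _; have := EF G; have := @bern_ge0 R _ p G p01.
by case: (E G) (F G) => -[] // _ /(_ isT).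
Qed.

Lemma gnp_prob_union {R : realType} {A B I : finType} (p : R)
    (E : I -> pred (bigraph A B)) : 0 <= p <= 1 ->
  gnp_prob p (fun G => [exists i, E i G]) <= \sum_i gnp_prob p (E i).
Proof.
move=> p01; rewrite /gnp_prob.
rewrite (eq_bigr (fun i => \sum_G if E i G then gnp_mass p G else 0)).
  2: by move=> i _; rewrite big_mkcond.
rewrite exchange_big /= big_mkcond; apply: ler_sum => G _.
have m0 : 0 <= gnp_mass p G := @bern_ge0 R _ p G p01.
have s0 (P : pred I) : 0 <= \sum_(i | P i) (if E i G then gnp_mass p G else 0).
  by apply: sumr_ge0 => i _; case: ifP.
case: existsP => [[i Ei]|_]; last exact: s0.
by rewrite (bigD1 i) //= Ei lerDl.
Qed.

(** For a fixed [U] the vertices of [B] fail independently, all of them with probability at most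
    [(1 - q) ^+ #|B| <= expR (- (#|B| * q))]; the number of sets [U] is [2 ^ #|A| <= expR #|A|]. *)
Lemma gnp_prob_not_expanding {R : realType} {A B : finType} (p theta x q : R) :
  0 <= p <= 1 ->
  (forall U : {set A}, x < #|U|%:R ->
    q <= \sum_(X : {set A} | theta * Num.sqrt #|U|%:R <= #|X :&: U|%:R) bern p X) ->
  gnp_prob p (fun G : bigraph A B => ~~ expanding theta x G) <=
  expR (#|A|%:R - #|B|%:R * q).
Proof.
move=> p01 qP.
pose E (U : {set A}) (G : bigraph A B) := (x < #|U|%:R) &&
  [forall w, ~~ (theta * Num.sqrt #|U|%:R <= #|conbhd G w :&: U|%:R)].
apply: (@le_trans _ _ (gnp_prob p (fun G => [exists U, E U G]))).
  apply: gnp_prob_sub => // G; rewrite negb_forall => /existsP[U].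
  rewrite negb_imply => /andP[xU]; rewrite negb_exists => EU.
  by apply/existsP; exists U; rewrite /E xU.
apply: le_trans (gnp_prob_union _ _ p01) _.
apply: (@le_trans _ _ (\sum_(U : {set A}) expR (- (#|B|%:R * q)))).
  apply: ler_sum => U _; have [xU|xU] := boolP (x < #|U|%:R); last first.
    by rewrite /gnp_prob big1 ?expR_ge0 // => G; rewrite /E (negbTE xU).
  pose Q := fun X : {set A} => ~~ (theta * Num.sqrt #|U|%:R <= #|X :&: U|%:R).
  apply: (@le_trans _ _ (gnp_prob p (fun G : bigraph A B => [forall w, Q (conbhd G w)]))).
    by apply: gnp_prob_sub => // G /andP[].
  rewrite gnp_prob_conbhd -mulrN expRM_natl lerXn2r ?nnegrE ?expR_ge0 //.
    by apply: sumr_ge0 => X _; exact: bern_ge0.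
  apply: le_trans (expR_ge1Dx _); rewrite lerBrDr.
  rewrite -(@sum_bern R A p) [leRHS](bigID (fun X => Q X)) /= lerD2l.
  by under eq_bigl => X do rewrite /Q negbK; exact: qP.
rewrite sumr_const -[leLHS]mulr_natl expRD ler_wpM2r ?expR_ge0 //.
rewrite (eq_card (_ : _ =i powerset [set: A]%SET)); last first.
  by move=> U; rewrite !inE finset.subsetT.
rewrite card_powerset cardsT natrX -[#|A|%:R]mulr1 expRM_natl.
rewrite lerXn2r ?nnegrE ?expR_ge0 //.
by have := @expR_ge1Dx R 1; rewrite -natr1.
Qed.

(** * Lower bound on the expansion probability *)

Lemma expRN_le_onem {R : realType} (p : R) :
  0 <= p <= 2^-1 -> expR (- (2 * p)) <= 1 - p.
Proof.
move=> /andP[p0 p2]; rewrite expRN -[leRHS]invrK.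
have h := @expR_ge1Dx R (2 * p).
rewrite lef_pV2 ?posrE ?expR_gt0 ?invr_gt0 //; last by lra.
apply: le_trans h; rewrite -div1r ler_pdivrMr; last by lra.
nra.
Qed.

(** From [1 / z <= 1 + 1 / z <= expR (1 / z)]. It is applied at [z = s * p / g], where
    [g / z = g ^ 2 / (s * p)]. *)
Lemma exprn_ge_expR {R : realType} (z : R) (g : nat) :
  0 < z -> expR (- (g%:R / z)) <= z ^+ g.
Proof.
move=> z0; rewrite -mulrN expRM_natl lerXn2r ?nnegrE ?expR_ge0 ?(ltW z0) //.
rewrite expRN -[leRHS]invrK lef_pV2 ?posrE ?expR_gt0 ?invr_gt0 //.
by apply: le_trans (expR_ge1Dx _); rewrite lerDr.
Qed.

Lemma prob_cap_ge_expR {R : realType} {T : finType} (p : R) (S U : {set T})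
    (g : nat) :
  0 < p <= 2^-1 -> S \subset U -> (0 < g <= #|S|)%N ->
  expR (- (g%:R ^+ 2 / (#|S|%:R * p) + 2 * p * #|S|%:R)) <=
  \sum_(X : {set T} | (g <= #|X :&: U|)%N) bern p X.
Proof.
move=> /andP[p0 p2] SU /andP[g0 gS].
have p01 : 0 <= p <= 1 by rewrite ltW //=; lra.
have s0 : (0 : R) < #|S|%:R by rewrite ltr0n (leq_trans g0).
have g0' : (0 : R) < g%:R by rewrite ltr0n.
apply: le_trans (_ : _ <= \sum_(X : {set T} | (g <= #|X :&: S|)%N) bern p X) _.
  apply: le_trans (prob_cap_ge _ _ _ p01 gS).
  rewrite opprD expRD ler_pM ?expR_ge0 //.
    apply: le_trans (exprn_ge_expR _ _ _); last by rewrite divr_gt0 ?mulr_gt0.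
    by rewrite invf_div mulrA expr2.
  rewrite mulrC -mulrN expRM_natl lerXn2r ?nnegrE ?expR_ge0 //; first by lra.
  by apply: expRN_le_onem; rewrite ltW.
rewrite big_mkcond [leRHS]big_mkcond; apply: ler_sum => X _.
have := @bern_ge0 R T p X p01.
case: ifP => [gX|_]; last by case: ifP.
by rewrite (leq_trans gX) // subset_leq_card // finset.setIS.
Qed.

(* The parameters are those of the greedy bound with [M = alpha * L / p >= a]
   and [theta = c * L / sqrt M]; [S] is a part of [U] of density [c], small
   enough for the factor [(1 - p) ^+ #|S|] to be [n ^ (- O(c))]. *)
Lemma expansion_prob {R : realType} {T : finType} (alpha c L p : R)
    (U : {set T}) :
  let M := alpha * L / p in
  0 < alpha -> 0 < c < 1 -> 0 < p <= 2^-1 -> 4 * alpha <= L ->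
  alpha <= c ^+ 2 * L -> p * L <= alpha -> p^-1 < #|U|%:R <= M ->
  expR (- ((4 / alpha + 2 * alpha) * c * L + 2)) <=
  \sum_(X : {set T} |
      c * L / Num.sqrt M * Num.sqrt #|U|%:R <= #|X :&: U|%:R) bern p X.
Proof.
move=> M al0 /andP[c0 c1] /andP[p0 p2] L4 cL pL /andP[Up UM].
have L0 : 0 < L by lra.
have M0 : 0 < M by rewrite divr_gt0 ?mulr_gt0.
have U0 : (0 : R) < #|U|%:R by rewrite (lt_trans _ Up) // invr_gt0.
have Up1 : 1 < #|U|%:R * p by move: Up; rewrite -div1r ltr_pdivrMr.
have Mp : M * p = alpha * L by rewrite /M divfK ?gt_eqF.
set theta := c * L / Num.sqrt M; set t := Num.sqrt #|U|%:R.
have r0 : 0 < Num.sqrt M by rewrite sqrtr_gt0.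
have rM : Num.sqrt M ^+ 2 = M by rewrite sqr_sqrtr // ltW.
have th0 : 0 < theta by rewrite divr_gt0 ?mulr_gt0.
have t0 : 0 < t by rewrite sqrtr_gt0.
have tU : t ^+ 2 = #|U|%:R by rewrite sqr_sqrtr // ltW.
have th2 : theta ^+ 2 = c ^+ 2 * L * p / alpha.
  rewrite /theta expr_div_n rM /M exprMn; field.
  by rewrite !gt_eqF.
clearbody theta t.
have tht0 : 0 <= theta * t by rewrite mulr_ge0 // ltW.
(* Being at least 1, [theta * t] at most doubles when rounded up to the integer [g]. *)
have tht1 : 1 <= theta * t.
  rewrite -(@expr_ge1 _ 2) // exprMn th2 tU.
  rewrite mulrAC ler_pdivlMr // mul1r (le_trans cL) //.
  have -> : c ^+ 2 * L * p * #|U|%:R = c ^+ 2 * L * (#|U|%:R * p) by ring.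
  by rewrite ler_peMr ?(ltW Up1) // mulr_ge0 ?sqr_ge0 // ltW.
(* Rounding is strictly upwards; [s] still fits in [U] because [c < 1]. *)
pose s := (Num.truncn (c * #|U|%:R)).+1.
pose g := (Num.truncn (theta * t)).+1.
have cU0 : 0 <= c * #|U|%:R by rewrite mulr_ge0 // ltW.
have sU : (s <= #|U|)%N by rewrite truncn_lt_nat // gtr_pMl.
have [s1 s2] : c * #|U|%:R < s%:R /\ s%:R <= c * #|U|%:R + 1.
  have /andP[h1 h2] := truncn_itv cU0; split=> //.
  by rewrite -natr1 lerD2r.
have [g1 g2] : theta * t < g%:R /\ g%:R <= 2 * (theta * t).
  have /andP[h1 h2] := truncn_itv tht0; split=> //.
  by rewrite /g -[leLHS]natr1; lra.
have [S [SU cardS]] : exists S : {set T}, S \subset U /\ #|S| = s.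
  have : (0 < #|[set S : {set T} | S \subset U & #|S| == s]|)%N.
    by rewrite cards_draws bin_gt0.
  by case/card_gt0P => S; rewrite inE => /andP[? /eqP ?]; exists S.
(* It suffices that [2 * theta <= c * t]. Squared, this follows from [L * p <= alpha] and
   [#|U| >= 4]; the latter holds because [4 * alpha <= L] gives [p <= 1 / 4]. *)
have gs : (g <= s)%N.
  rewrite -(ler_nat R) (le_trans g2) // (le_trans _ (ltW s1)) // -tU.
  rewrite expr2 !mulrA ler_pM2r //.
  have le2 : (2 * theta) ^+ 2 <= (c * t) ^+ 2.
    rewrite !exprMn th2 tU.
    have U4 : 4 <= #|U|%:R :> R.
      have p4 : 4 * p <= 1 by rewrite -(ler_pM2l al0); nra.
      by rewrite -(ler_pM2r p0); lra.
    have Lp1 : L * p / alpha <= 1 by rewrite ler_pdivrMr // mul1r mulrC.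
    have -> : 2 ^+ 2 * (c ^+ 2 * L * p / alpha) = c ^+ 2 * (4 * (L * p / alpha)).
      by ring.
    by rewrite ler_wpM2l ?sqr_ge0 //; lra.
  by move: le2; rewrite ler_pXn2r // nnegrE mulr_ge0 // ltW.
have gpos : (0 < g <= #|S|)%N by rewrite cardS.
have p02 : 0 < p <= 2^-1 by rewrite p0.
apply: le_trans (_ : _ <= \sum_(X : {set T} | (g <= #|X :&: U|)%N) bern p X) _.
  apply: le_trans (prob_cap_ge_expR _ _ _ _ p02 SU gpos).
  rewrite ler_expR lerN2 cardS.
  (* The size of [U] cancels here, since [g ^ 2 <= 4 * theta ^ 2 * #|U|] and [s >= c * #|U|]. In
     [e2] it is bounded by [M], and the additive 2 absorbs the rounding of [s]. *)
  have e1 : g%:R ^+ 2 / (s%:R * p) <= 4 / alpha * c * L.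
    rewrite ler_pdivrMr ?mulr_gt0 ?(lt_le_trans _ (ltW s1)) ?mulr_gt0 //.
    have g22 : g%:R ^+ 2 <= (2 * (theta * t)) ^+ 2.
      by rewrite ler_pXn2r // nnegrE ?ler0n ?(mulr_ge0 _ tht0).
    rewrite (le_trans g22) // !exprMn th2 tU.
    have -> : 2 ^+ 2 * (c ^+ 2 * L * p / alpha * #|U|%:R) =
      4 / alpha * c * L * (c * #|U|%:R * p) by ring.
    by rewrite ler_wpM2l ?mulr_ge0 ?invr_ge0 ?ler_wpM2r // ltW.
  have e2 : 2 * p * s%:R <= 2 * alpha * c * L + 2.
    have pU : c * (#|U|%:R * p) <= c * (alpha * L) by rewrite ler_pM2l // -Mp ler_pM2r.
    have ps : p * s%:R <= p * (c * #|U|%:R + 1) by rewrite ler_pM2l.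
    by lra.
  by lra.
have p01 : 0 <= p <= 1 by rewrite ltW //=; lra.
rewrite big_mkcond [leRHS]big_mkcond; apply: ler_sum => X _.
have := @bern_ge0 R T p X p01.
case: ifP => [gX|_]; last by case: ifP.
by rewrite (le_trans (ltW g1)) // ler_nat.
Qed.

(** * The conditional probability for fixed parameters *)

Lemma gnp_prob_undominated {R : realType} {A B : finType} (alpha c L p F : R) :
  0 < alpha -> 0 < c < 1 -> 0 < p <= 2^-1 -> 4 * alpha <= L ->
  alpha <= c ^+ 2 * L -> p * L <= alpha -> #|A|%:R * p <= alpha * L ->
  2 * alpha / c + 1 <= F ->
  gnp_prob p (fun G : bigraph A B => no_isolated G &&
    ~~ [exists D : {set B}, dominating G D && (#|D|%:R <= F / p)]) <=
  expR (#|A|%:R - #|B|%:R * expR (- ((4 / alpha + 2 * alpha) * c * L + 2))).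
Proof.
move=> al0 c01 p02 L4 cL pL aM cF.
have /andP[c0 c1] := c01; have /andP[p0 p2] := p02.
have p01 : 0 <= p <= 1 by rewrite ltW //=; lra.
have L0 : 0 < L by lra.
have AM : #|A|%:R <= alpha * L / p by rewrite ler_pdivlMr.
set M := alpha * L / p in AM.
have M0 : 0 < M by rewrite divr_gt0 ?mulr_gt0.
have r0 : 0 < Num.sqrt M by rewrite sqrtr_gt0.
have rM : Num.sqrt M ^+ 2 = M by rewrite sqr_sqrtr // ltW.
have th0 : 0 < c * L / Num.sqrt M by rewrite divr_gt0 ?mulr_gt0.
apply: le_trans (_ : _ <= gnp_prob p (fun G : bigraph A B =>
  ~~ expanding (c * L / Num.sqrt M) p^-1 G)) _; last first.
  apply: gnp_prob_not_expanding => // U pU; apply: expansion_prob => //.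
  by rewrite pU (le_trans _ AM) // ler_nat max_card.
apply: gnp_prob_sub => // G /andP[isoG]; apply: contra => expG.
have [|D [domD cardD]] := expanding_dominating _ _ G th0 _ expG isoG.
  by rewrite invr_ge0 ltW.
apply/existsP; exists D; rewrite domD (le_trans cardD) //.
(* Replacing [#|A|] by its upper bound [M] turns the greedy bound into [2 * M / (c * L) + 1 / p = (2
   * alpha / c + 1) / p]. *)
have -> : 2 * Num.sqrt #|A|%:R / (c * L / Num.sqrt M) =
    2 / (c * L) * (Num.sqrt #|A|%:R * Num.sqrt M).
  by field; rewrite !gt_eqF.
apply: le_trans (_ : 2 / (c * L) * M + p^-1 <= _).
  rewrite lerD2r ler_pM2l ?divr_gt0 ?mulr_gt0 //.
  by rewrite -[leRHS]rM expr2 ler_pM2r // ler_wsqrtr.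
have -> : 2 / (c * L) * M + p^-1 = (2 * alpha / c + 1) / p.
  by rewrite /M; field; rewrite !gt_eqF.
by rewrite ler_pM2r // invr_gt0.
Qed.

Lemma bernoulli_inequality {R : realType} (h : R) (k : nat) :
  0 <= h <= 1 -> 1 - k%:R * h <= (1 - h) ^+ k.
Proof.
move=> /andP[h0 h1]; elim: k => [|k IHk]; first by rewrite mul0r subr0 expr0.
rewrite exprS -natr1; have k0 : (0 : R) <= k%:R by exact: ler0n.
have : (1 - h) * (1 - k%:R * h) <= (1 - h) * (1 - h) ^+ k.
  by rewrite ler_wpM2l // subr_ge0.
by have := mulr_ge0 k0 (sqr_ge0 h); nra.
Qed.

Lemma gnp_cond_compl {R : realType} {A B : finType} (p d : R)
    (E F : pred (bigraph A B)) :
  0 < gnp_prob p F -> gnp_prob p (fun G => F G && ~~ E G) <= d * gnp_prob p F ->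
  1 - d <= gnp_cond p E F.
Proof.
move=> F0 dF; rewrite /gnp_cond ler_pdivlMr // mulrBl mul1r lerBlDr.
apply: le_trans (lerD (lexx _) dF).
rewrite /gnp_prob (bigID E) /= le_eqVlt; apply/orP; left; apply/eqP.
by congr (_ + _); apply: eq_bigl => G; rewrite andbC.
Qed.

(** Bernoulli's inequality gives the conditioning event probability at least 1/2, so conditioning
    costs a factor [2 <= expR 1]. The exponent [#|A| - #|B| * q + 1] is then at most
    [- #|B| * q / 4], half of [#|B| * q] paying for [#|A|] and a quarter for the 1. *)
Lemma gnp_cond_dominated {R : realType} {A B : finType} (alpha c L p F : R) :
  let q := expR (- ((4 / alpha + 2 * alpha) * c * L + 2)) in
  0 < alpha -> 0 < c < 1 -> 0 < p <= 2^-1 -> 4 * alpha <= L ->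
  alpha <= c ^+ 2 * L -> p * L <= alpha -> #|A|%:R * p <= alpha * L ->
  2 * alpha / c + 1 <= F ->
  2 * #|A|%:R <= #|B|%:R * q -> 4 <= #|B|%:R * q ->
  #|A|%:R * (1 - p) ^+ #|B| <= 2^-1 ->
  1 - expR (- (#|B|%:R * q / 4)) <=
  gnp_cond p
    (fun G : bigraph A B =>
       [exists D : {set B}, dominating G D && (#|D|%:R <= F / p)])
    (fun G : bigraph A B => no_isolated G).
Proof.
move=> q al0 c01 p02 L4 cL pL aM cF aq q4 iso.
have /andP[p0 p2] := p02.
have isoP : 2^-1 <= gnp_prob p (fun G : bigraph A B => no_isolated G).
  rewrite gnp_prob_no_isolated; apply: le_trans (bernoulli_inequality _ _ _); last first.
    by rewrite exprn_ge0 ?exprn_ile1; lra.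
  by lra.
apply: gnp_cond_compl; first by apply: lt_le_trans isoP; rewrite invr_gt0.
apply: le_trans (@gnp_prob_undominated R A B _ _ _ _ _ al0 c01 p02 L4 cL pL aM cF) _.
rewrite -/q; apply: le_trans (_ : expR (- (#|B|%:R * q / 4)) * 2^-1 <= _); last first.
  by rewrite ler_wpM2l ?expR_ge0.
rewrite ler_pdivlMr // -[leRHS]mulr1.
have e1 := @expR_ge1Dx R 1.
apply: le_trans (_ : expR (#|A|%:R - #|B|%:R * q) * expR 1 <= _).
  by rewrite ler_wpM2l ?expR_ge0 //; lra.
by rewrite mulr1 -expRD ler_expR; lra.
Qed.

(** * Asymptotics *)

Lemma expR_ge_sqr {R : realType} (x : R) : 0 <= x -> x ^+ 2 / 4 <= expR x.
Proof.
move=> x0; have -> : x = x / 2 + x / 2 by lra.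
rewrite expRD; have := @expR_ge1Dx R (x / 2); nra.
Qed.

(** After multiplication by [p], the left side is at most [2 * alpha * L], whereas the right side is
    at least [expR (beta * L - k * L - 2) >= expR (beta * L / 4)], which exceeds
    [(beta * L) ^ 2 / 64]. *)
Lemma expansion_dominates {R : realType} (alpha beta k L p a b : R) :
  0 < alpha -> 0 < beta -> 0 < p -> k <= beta / 2 ->
  8 / beta <= L -> 128 * alpha / beta ^+ 2 <= L ->
  a * p <= alpha * L -> expR (beta * L) <= b * p ->
  2 * a <= b * expR (- (k * L + 2)).
Proof.
move=> al0 be0 p0 kb L1 L2 ap bp.
have L0 : 0 < L by apply: lt_le_trans L1; rewrite divr_gt0.
have bL : 8 <= beta * L by move: L1; rewrite ler_pdivrMr // mulrC.
have b2L : 128 * alpha <= beta ^+ 2 * L.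
  by move: L2; rewrite ler_pdivrMr ?exprn_gt0 // [L * _]mulrC.
rewrite -(ler_pM2r p0).
apply: le_trans (_ : expR (beta * L) * expR (- (k * L + 2)) <= _); last first.
  by rewrite mulrAC ler_pM2r ?expR_gt0.
rewrite -expRD; apply: le_trans (_ : expR (beta * L / 4) <= _); last first.
  rewrite ler_expR; have : k * L <= beta / 2 * L by rewrite ler_pM2r.
  lra.
apply: le_trans (expR_ge_sqr _ _); last by rewrite divr_ge0 ?mulr_ge0 ?ltW.
have : 128 * alpha * L <= beta ^+ 2 * L * L by rewrite ler_pM2r.
rewrite exprMn exprMn; lra.
Qed.

(** Here [b * p >= expR (beta * L) >= (beta * L) ^ 2 / 4 >= 2 * L >= L + 1], so
    [(1 - p) ^+ b <= expR (- (b * p))] beats [a <= expR L] by a factor [expR 1 >= 2]. *)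
Lemma isolated_bound {R : realType} (beta L p a : R) (b : nat) :
  0 < beta -> 0 < p <= 1 -> 1 <= L -> 8 / beta ^+ 2 <= L ->
  0 <= a <= expR L -> expR (beta * L) <= b%:R * p ->
  a * (1 - p) ^+ b <= 2^-1.
Proof.
move=> be0 /andP[p0 p1] L1 L2 /andP[a0 aL] bp.
have b2L : 8 <= beta ^+ 2 * L.
  by move: L2; rewrite ler_pdivrMr ?exprn_gt0 // mulrC.
have pb : (1 - p) ^+ b <= expR (- (L + 1)).
  apply: le_trans (_ : expR (- p) ^+ b <= _).
    by rewrite lerXn2r ?nnegrE ?expR_ge0 ?subr_ge0 //; exact: expR_ge1Dx.
  rewrite -expRM_natl ler_expR mulrN lerN2 (le_trans _ bp) //.
  have bL0 : 0 <= beta * L by rewrite mulr_ge0 ?ltW // (lt_le_trans _ L1).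
  apply: le_trans (expR_ge_sqr _ bL0).
  have : 8 * L <= beta ^+ 2 * L * L by rewrite ler_pM2r // (lt_le_trans _ L1).
  rewrite exprMn; lra.
apply: le_trans (_ : expR L * expR (- (L + 1)) <= _).
  by rewrite ler_pM // exprn_ge0 // subr_ge0.
rewrite -expRD (_ : L - (L + 1) = -1); last by lra.
rewrite expRN lef_pV2 ?posrE ?expR_gt0 //.
by have := @expR_ge1Dx R 1; lra.
Qed.

(** Since [ln b >= beta * L], the correction to the exponent lowers the logarithm by at least
    [k * L + 4]; of this 4, one 2 matches the exponential and the other pays for the division by
    4. *)
Lemma powR_le_expansion {R : realType} (beta k L b : R) :
  0 < beta -> 0 <= k -> 0 < L -> 0 < b -> beta * L <= ln b ->
  b `^ (1 - (k + 4 / L) / beta) <= b * expR (- (k * L + 2)) / 4.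
Proof.
move=> be0 k0 L0 b0 lnb.
have e4 : expR (- 2) <= 4^-1 :> R.
  rewrite expRN lef_pV2 ?posrE ?expR_gt0 //.
  rewrite (_ : 2 = 1 + 1 :> R) // expRD; have := @expR_ge1Dx R 1; nra.
apply: le_trans (_ : b * expR (- (k * L + 2)) * expR (- 2) <= _); last first.
  by rewrite ler_pM2l // mulr_gt0 // expR_gt0.
rewrite -{2}(lnK (b0 : b \is Num.pos)) -!expRD /powR gt_eqF // ler_expR.
have : (k + 4 / L) / beta * (beta * L) <= (k + 4 / L) / beta * ln b.
  by rewrite ler_wpM2l // divr_ge0 ?addr_ge0 ?divr_ge0 // ltW.
have -> : (k + 4 / L) / beta * (beta * L) = k * L + 4.
  by field; rewrite !gt_eqF.
lra.
Qed.

Local Open Scope classical_set_scope.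
Local Open Scope ring_scope.

Lemma ln_natr_cvgy {R : realType} : ln (n%:R : R) @[n --> \oo] --> +oo.
Proof.
apply/cvgryPge => K; near=> n.
have Kn : expR K <= n%:R by near: n; exact: nbhs_infty_ger.
by rewrite -[leLHS]expRK ler_ln ?posrE ?expR_gt0 // (lt_le_trans _ Kn) ?expR_gt0.
Unshelve. all: by end_near. Qed.

(* As a choice of [c], the first summand bounds the number of greedy steps by
   [(f - 1) / p], and the second makes each step cover at least one vertex. *)
Lemma density_near0 {R : realType} (alpha : R) (f L : nat -> R) :
  0 < alpha -> f n @[n --> \oo] --> +oo -> L n @[n --> \oo] --> +oo ->
  forall e : R, 0 < e -> \forall n \near \oo,
    0 < 2 * alpha / (f n - 1) + Num.sqrt (alpha / L n) <= e.
Proof.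
move=> al0 /cvgryPge fy /cvgryPge Ly e e0; near=> n.
have f1 : 1 + 4 * alpha / e <= f n by near: n; exact: fy.
have L1 : 4 * alpha / e ^+ 2 <= L n by near: n; exact: Ly.
have L0 : 0 < L n by rewrite (lt_le_trans _ L1) // divr_gt0 ?exprn_gt0 ?mulr_gt0.
have f0 : 0 < f n - 1.
  by rewrite subr_gt0 (lt_le_trans _ f1) // ltrDl divr_gt0 ?mulr_gt0.
apply/andP; split; first by rewrite ltr_pwDl ?sqrtr_ge0 ?divr_gt0 ?mulr_gt0.
have h1 : 2 * alpha / (f n - 1) <= e / 2.
  rewrite ler_pdivrMr //.
  have : 4 * alpha / e <= f n - 1 by lra.
  by rewrite ler_pdivrMr //; lra.
have h2 : Num.sqrt (alpha / L n) <= e / 2.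
  rewrite -[leRHS]ger0_norm ?divr_ge0 ?(ltW e0) // -sqrtr_sqr ler_wsqrtr //.
  rewrite ler_pdivrMr //; move: L1; rewrite ler_pdivrMr ?exprn_gt0 //.
  lra.
lra.
Unshelve. all: by end_near. Qed.

Theorem theorem1p2 (R : realType) (alpha beta : R)
    (halpha : 0 < alpha) (hbeta : 0 < beta)
    (f : nat -> R) (hf : f n @[n --> \oo] --> +oo)
    (a b : nat -> nat) (p : nat -> R)
    (A B : nat -> finType)
    (hA : forall n, #|A n| = a n) (hB : forall n, #|B n| = b n)
    (hp : \forall n \near \oo, 0 < p n <= 1)
    (hlna : \forall n \near \oo, (ln (n%:R : R)) ^+ 2 <= (a n)%:R)
    (hab : \forall n \near \oo, (a n <= b n <= n)%N)
    (hap : \forall n \near \oo, (a n)%:R * p n <= alpha * ln n%:R)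
    (hbp : \forall n \near \oo, n%:R `^ beta < (b n)%:R * p n) :
  exists eps : nat -> R,
    (eps n @[n --> \oo] --> (0 : R)) /\
    \forall n \near \oo,
      1 - expR (- ((b n)%:R `^ (1 - eps n))) <=
      gnp_cond (p n)
        (fun G : bigraph (A n) (B n) =>
           [exists D : {set B n},
              dominating G D && (#|D|%:R <= f n / p n)])
        (fun G : bigraph (A n) (B n) => no_isolated G).
Proof.
pose L n : R := ln n%:R.
have Ly : L n @[n --> \oo] --> +oo := ln_natr_cvgy.
have /cvgryPge Lge := Ly.
pose c n := 2 * alpha / (f n - 1) + Num.sqrt (alpha / L n).
have c_near := density_near0 _ _ _ halpha hf Ly.
pose K := 4 / alpha + 2 * alpha.
have K0 : 0 < K by rewrite addr_gt0 ?divr_gt0 ?mulr_gt0.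
(* The exponent loss of [powR_le_expansion] at [k = K * c n]. *)
exists (fun n => (K * c n + 4 / L n) / beta); split.
  apply/cvgr0Pnorm_le => e e0; near=> n.
  have eb : 0 < e * beta by rewrite mulr_gt0.
  have L1 : 8 / (e * beta) <= L n by near: n; exact: Lge.
  have L0 : 0 < L n by rewrite (lt_le_trans _ L1) // divr_gt0.
  have /andP[c0 ce] : 0 < c n <= e * beta / (2 * K).
    by near: n; apply: c_near; rewrite divr_gt0 // mulr_gt0.
  rewrite ger0_norm; last first.
    by rewrite ltW // divr_gt0 // (addr_gt0 (mulr_gt0 K0 c0)) // divr_gt0.
  rewrite ler_pdivrMr //.
  have h1 : K * c n <= e * beta / 2.
    move: ce; rewrite ler_pdivlMr ?mulr_gt0 //; lra.
  have h2 : 4 / L n <= e * beta / 2.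
    rewrite ler_pdivrMr //; move: L1; rewrite ler_pdivrMr //; lra.
  lra.
near=> n.
have /andP[p0 p1] : 0 < p n <= 1 by near: n.
have aL : L n ^+ 2 <= (a n)%:R by near: n.
have /andP[ab bn] : (a n <= b n <= n)%N by near: n.
have ap : (a n)%:R * p n <= alpha * L n by near: n.
have bp : n%:R `^ beta < (b n)%:R * p n by near: n.
have L2 : 2 <= L n by near: n; exact: Lge.
have L4 : 4 * alpha <= L n by near: n; exact: Lge.
have L8 : 8 / beta <= L n by near: n; exact: Lge.
have L8' : 8 / beta ^+ 2 <= L n by near: n; exact: Lge.
have L128 : 128 * alpha / beta ^+ 2 <= L n by near: n; exact: Lge.
have f2 : 2 <= f n by near: n; move/cvgryPge: hf; apply.
have /andP[c0 c2] : 0 < c n <= 2^-1 by near: n; apply: c_near.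
have /andP[_ cb] : 0 < c n <= beta / (2 * K).
  by near: n; apply: c_near; rewrite divr_gt0 // mulr_gt0.
have n0 : (0 : R) < n%:R by rewrite ltr0n; near: n; exact: nbhs_infty_gt.
have L0 : 0 < L n by lra.
have {}bp : expR (beta * L n) <= (b n)%:R * p n.
  by move: bp; rewrite /powR gt_eqF // => /ltW.
have b0 : (0 : R) < (b n)%:R.
  by rewrite -(pmulr_lgt0 _ p0) (lt_le_trans _ bp) ?expR_gt0.
have lnb : beta * L n <= ln (b n)%:R.
  rewrite -[leLHS]expRK ler_ln ?posrE ?expR_gt0 // (le_trans bp) //.
  by rewrite ler_piMr // ltW.
(* This is where [ln n ^ 2 <= a] enters: it gives [p * L ^ 2 <= a * p <= alpha * L]. *)
have pL : p n * L n <= alpha.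
  rewrite -(ler_pM2r L0); apply: le_trans ap.
  by rewrite -mulrA mulrC -expr2 ler_pM2r.
have p2 : p n <= 2^-1 by rewrite -(ler_pM2l halpha); nra.
have aq : 2 * (a n)%:R <= (b n)%:R * expR (- (K * c n * L n + 2)).
  apply: (@expansion_dominates R alpha beta _ _ (p n)) => //.
  move: cb; rewrite ler_pdivlMr ?mulr_gt0 //; lra.
have cL : alpha <= c n ^+ 2 * L n.
  rewrite -ler_pdivrMr // -[leLHS]sqr_sqrtr ?divr_ge0 ?(ltW halpha) ?(ltW L0) //.
  rewrite ler_pXn2r ?nnegrE ?sqrtr_ge0 ?(ltW c0) //.
  by rewrite lerDr divr_ge0 ?mulr_ge0 ?ltW //; lra.
have cf : 2 * alpha / c n + 1 <= f n.
  rewrite -lerBrDr ler_pdivrMr // [leRHS]mulrC -ler_pdivrMr; last by lra.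
  by rewrite lerDl sqrtr_ge0.
apply: le_trans (_ : 1 - expR (- ((b n)%:R * expR (- (K * c n * L n + 2)) / 4)) <= _).
  rewrite lerD2l lerN2 ler_expR lerN2.
  by apply: powR_le_expansion; rewrite // mulr_ge0 // ltW.
rewrite -{1}hB; apply: (@gnp_cond_dominated R (A n) (B n) alpha);
  rewrite ?hA ?hB ?c0 ?p0 //.
- lra.
(* [2 * a >= 2 * L ^ 2 >= 8]. *)
- by apply: le_trans aq; nra.
- apply: (@isolated_bound R beta (L n)) => //; first by rewrite p0.
  + lra.
  + by rewrite ler0n lnK ?posrE // ler_nat (leq_trans ab).
Unshelve. all: by end_near. Qed.
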